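(* Let $\mathbb G$ be an affine group scheme of finite type over $k$ and let $i_X: X\subset \mathcal O(\mathbb G)$ be a $k$-vector subspace. Let $i_{X*}: Mod(\mathbb G,X)\hookrightarrow Mod(\mathbb G)$ be the full subcategory of $Mod(\mathbb G)$ whose objects are the $X$-comodules. Then: (1) $Mod(\mathbb G,X)$ is an abelian subcategory of $Mod(\mathbb G)$ which is closed under filtering colimits. (2) Sending a $\mathbb G$-module $M$ to the $\mathbb G$-submodule $M_X\subset M$ determines a functor $(-)_X: Mod(\mathbb G)\to Mod(\mathbb G,X)$. (3) The functor $(-)_X$ is left exact and is right adjoint to the embedding functor $i_{X*}: Mod(\mathbb G,X)\to Mod(\mathbb G)$.
   Context: $k$ is a field of characteristic $p>0$. $\mathcal O(\mathbb G)$ is the coordinate algebra of $\mathbb G$, and $Mod(\mathbb G)$ is the abelian category of $\mathbb G$-modules, i.e. right $\mathcal O(\mathbb G)$-comodules, a module $M$ having coaction $\Delta_M: M\to M\otimes\mathcal O(\mathbb G)$ (tensor products over $k$). For a subspace $X\subset\mathcal O(\mathbb G)$, an $X$-comodule is a $\mathbb G$-module $M$ such that $\Delta_M(M)\subset M\otimes X\subset M\otimes \mathcal O(\mathbb G)$; $Mod(\mathbb G,X)\subset Mod(\mathbb G)$ is the full subcategory of $X$-comodules. For a $\mathbb G$-module $M$, $M_X\subset M$ denotes the union of all $\mathbb G$-submodules $N\subset M$ which are $X$-comodules; it is a $\mathbb G$-submodule and is the largest $X$-comodule contained in $M$. *)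

(* Defs.v *)
From HB Require Import structures.
From mathcomp Require Import all_boot all_algebra.
From mathcomp Require Import boolp classical_sets.
From mathcomp Require Import freeg.

Set Implicit Arguments.
Unset Strict Implicit.
Unset Printing Implicit Defensive.

Import GRing.Theory.
Local Open Scope ring_scope.
Local Open Scope quotient_scope.

Section Subspaces.
Variables (k : fieldType) (V : lmodType k).

(* Vector subspaces are the [submodClosed V] of the library: boolean
   predicates closed under linear combinations. *)
Definition mk_subspace (S : {pred V}) (closedS : submod_closed S) :
    submodClosed V :=
  HB.pack_for (submodClosed V) S (GRing.isSubmodClosed.Build k V S closedS).

Definition mk_subgroup (S : {pred V}) (closedS : zmod_closed S) :
    zmodClosed V :=
  HB.pack_for (zmodClosed V) S (GRing.isZmodClosed.Build V S closedS).

Definition lspan_pred (P : V -> Prop) : {pred V} :=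
  fun v => `[< forall S : submodClosed V, (forall w, P w -> w \in S) ->
                 v \in S >].

Fact lspan_closed P : submod_closed (lspan_pred P).
Proof.
split=> [|a u v /asboolP hu /asboolP hv]; apply/asboolP => S PS.
  exact: rpred0.
by apply: rpredD; [apply: rpredZ; apply: hu | apply: hv].
Qed.

Definition lspan P : submodClosed V := mk_subspace (lspan_closed P).

Lemma mem_lspan (P : V -> Prop) v : P v -> v \in lspan P.
Proof. by move=> Pv; apply/asboolP => S; apply. Qed.

Lemma lspan_min (P : V -> Prop) (S : submodClosed V) :
  (forall w, P w -> w \in S) -> {subset lspan P <= S}.
Proof. by move=> PS v /asboolP; apply. Qed.

Variable S : submodClosed V.

Definition sub_space := {v : V | v \in S}.
HB.instance Definition _ := SubChoice.on sub_space.
HB.instance Definition _ := [SubChoice_isSubLmodule of sub_space by <:].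

Fact subspace_zmod_closed : zmod_closed S.
Proof.
split=> [|x y xS yS]; first exact: rpred0.
by rewrite -scaleN1r; apply: rpredD => //; apply: rpredZ.
Qed.

Definition quot_space := Quotient.quot (mk_subgroup subspace_zmod_closed).
HB.instance Definition _ := GRing.Zmodule.on quot_space.
HB.instance Definition _ := Quotient.on quot_space.

Definition quot_proj (x : V) : quot_space := \pi_quot_space x.

Lemma quot_projP (x y : V) : quot_proj x = quot_proj y <-> x - y \in S.
Proof.
rewrite (Quotient.idealrBE (mk_subgroup subspace_zmod_closed)).
by split=> [h|/eqP//]; apply/eqP.
Qed.

Lemma quot_projK (x : quot_space) : quot_proj (repr x) = x.
Proof. exact: reprK. Qed.

Lemma quot_ind (P : quot_space -> Prop) :
  (forall x, P (quot_proj x)) -> forall x, P x.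
Proof. by move=> h x; rewrite -(quot_projK x). Qed.

Lemma quot_projD x y : quot_proj (x + y) = quot_proj x + quot_proj y.
Proof. exact: (raddfD (\pi_quot_space)). Qed.

Definition quot_scale (a : k) (x : quot_space) : quot_space :=
  quot_proj (a *: repr x).

Lemma quot_projZ a x : quot_scale a (quot_proj x) = quot_proj (a *: x).
Proof.
apply/quot_projP; rewrite -scalerBr; apply: rpredZ.
by apply/quot_projP; rewrite quot_projK.
Qed.

Fact quot_scaleA a b x :
  quot_scale a (quot_scale b x) = quot_scale (a * b) x.
Proof. by elim/quot_ind: x => x; rewrite !quot_projZ scalerA. Qed.
Fact quot_scale1 : left_id 1 quot_scale.
Proof. by elim/quot_ind=> x; rewrite quot_projZ scale1r. Qed.
Fact quot_scaleDr : right_distributive quot_scale +%R.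
Proof.
move=> a; elim/quot_ind=> x; elim/quot_ind=> y.
by rewrite -quot_projD !quot_projZ scalerDr quot_projD.
Qed.
Fact quot_scaleDl x : {morph quot_scale^~ x : a b / a + b}.
Proof.
by move=> a b; elim/quot_ind: x => x; rewrite !quot_projZ scalerDl quot_projD.
Qed.
HB.instance Definition _ := GRing.Zmodule_isLmodule.Build k quot_space
  quot_scaleA quot_scale1 quot_scaleDr quot_scaleDl.

Fact quot_proj_linear : linear quot_proj.
Proof. by move=> a x y; rewrite quot_projD -quot_projZ. Qed.
HB.instance Definition _ :=
  GRing.isLinear.Build k V quot_space *:%R quot_proj quot_proj_linear.

End Subspaces.

Section Tensor.
Variables (k : fieldType) (V W : lmodType k).
Local Notation free := {freeg (V * W)%type / k}.
Local Notation gen v w := (<< (v, w) >> : free).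

(* The relations defining [V ⊗ W] as a quotient of the free vector space on
   [V * W]. *)
Definition tensor_relation (x : free) : Prop :=
  (exists a v v' w, x = gen (a *: v + v') w - (a *: gen v w + gen v' w)) \/
  (exists a v w w', x = gen v (a *: w + w') - (a *: gen v w + gen v w')).

Definition tensor : lmodType k := quot_space (lspan tensor_relation).

Definition pure_tensor (v : V) (w : W) : tensor := quot_proj _ (gen v w).

Definition bilin (U : lmodType k) (f : V -> W -> U) : Prop :=
  (forall w, linear (f^~ w)) /\ (forall v, linear (f v)).

(* The linear map on [V ⊗ W] induced by a bilinear map [f]; it is meaningless
   for other [f] (see [tensor_liftE]). *)
Definition tensor_lift (U : lmodType k) (f : V -> W -> U) (t : tensor) : U :=
  fglift (fun p => f p.1 p.2) (repr t).

Lemma pure_bilin : bilin pure_tensor.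
Proof.
split=> [w a v v'|v a w w']; rewrite /pure_tensor -linearP;
  apply/quot_projP/mem_lspan; [left|right].
- by exists a, v, v', w.
- by exists a, v, w, w'.
Qed.

Lemma fglift_linear (K : choiceType) (U : lmodType k) (f : K -> U) :
  linear (fglift f : {freeg K / k} -> U).
Proof.
have sub x y : fglift f (x - y) = fglift f x - fglift f y.
  exact: lift_is_additive.
have f0 : fglift f (0 : {freeg K / k}) = 0.
  by rewrite -(subrr (0 : {freeg K / k})) sub subrr.
have opp y : fglift f (- y) = - fglift f y.
  by rewrite -sub0r sub f0 sub0r.
have add x y : fglift f (x + y) = fglift f x + fglift f y.
  by rewrite -{1}(opprK y) sub opp opprK.
move=> a x y; rewrite add; congr (_ + _).
rewrite -(freeg_sumE x) scaler_sumr.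
elim: (dom x) => [|z s IHs]; first by rewrite !big_nil f0 scaler0.
rewrite !big_cons !add IHs scalerDr; congr (_ + _).
rewrite (_ : a *: _ = << a * coeff z x *g z >>); last first.
  apply/eqP/freeg_eqP => y'; rewrite coeffZ !coeffU; exact: mulrA.
by rewrite !liftU scalerA.
Qed.

Lemma fglift_gen (K : choiceType) (U : lmodType k) (f : K -> U) x :
  fglift f (<< x >> : {freeg K / k}) = f x.
Proof. by rewrite liftU scale1r. Qed.

Section Lift.
Variables (U : lmodType k) (f : V -> W -> U).
Hypothesis f_bilin : bilin f.
Let F := fglift (fun p : V * W => f p.1 p.2).

Let F_lin : linear (F : free -> U). Proof. exact: fglift_linear. Qed.
Let FL : {linear free -> U} :=
  HB.pack_for {linear free -> U} (F : free -> U)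
    (GRing.isLinear.Build k free U *:%R F F_lin).

Let ker_pred : {pred free} := fun x => FL x == 0.
Let ker_closed : submod_closed ker_pred.
Proof.
split=> [|a x y /eqP hx /eqP hy]; apply/eqP; first by rewrite linear0.
by rewrite linearP hx hy scaler0 addr0.
Qed.

Let lift_rel x : x \in lspan tensor_relation -> F x = 0.
Proof.
move=> hx; apply/eqP.
apply: (lspan_min (S := mk_subspace ker_closed) _ hx) => {hx}.
have Fg v w : FL (gen v w) = f v w by rewrite /= /F fglift_gen.
move=> w [[a [u [v [z ->]]]]|[a [u [v [z ->]]]]]; apply/eqP;
  rewrite linearB linearP !Fg.
- by rewrite f_bilin.1 subrr.
- by rewrite f_bilin.2 subrr.
Qed.

Lemma tensor_lift_proj x : tensor_lift f (quot_proj _ x) = F x.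
Proof.
apply/eqP; rewrite -subr_eq0; apply/eqP.
have <- : F (repr (quot_proj (lspan tensor_relation) x) - x) =
   tensor_lift f (quot_proj (lspan tensor_relation) x) - F x.
  exact: (linearB FL).
by apply: lift_rel; apply/quot_projP; rewrite quot_projK.
Qed.

Lemma tensor_liftE v w : tensor_lift f (pure_tensor v w) = f v w.
Proof. by rewrite tensor_lift_proj /F fglift_gen. Qed.

Lemma tensor_lift_linear : linear (tensor_lift f).
Proof.
move=> a; elim/quot_ind=> x; elim/quot_ind=> y.
by rewrite -linearP !tensor_lift_proj F_lin.
Qed.

Definition tensor_lift_lin : {linear tensor -> U} :=
  HB.pack_for {linear tensor -> U} (tensor_lift f)
    (GRing.isLinear.Build k tensor U *:%R _ tensor_lift_linear).
End Lift.

Lemma tensor_ind (P : tensor -> Prop) :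
  (forall v w, P (pure_tensor v w)) ->
  (forall a x y, P x -> P y -> P (a *: x + y)) -> forall x, P x.
Proof.
move=> Pp PD x.
have P0 : P 0 by rewrite -(addNr (pure_tensor 0 0)) -scaleN1r; apply: PD.
elim/quot_ind: x => x; rewrite -(freeg_sumE x).
elim: (dom _) => [|z s IHs]; first by rewrite big_nil linear0.
rewrite big_cons.
set c := coeff z _ in IHs *.
have -> : << c *g z >> = c *: gen z.1 z.2 :> free.
  apply/eqP/freeg_eqP => y'; rewrite coeffZ !coeffU -surjective_pairing.
  by rewrite mul1r.
by rewrite linearP; apply: PD => //; exact: Pp.
Qed.

Lemma tensor_ext (U : lmodType k) (f g : {linear tensor -> U}) :
  (forall v w, f (pure_tensor v w) = g (pure_tensor v w)) -> f =1 g.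
Proof.
move=> fg; elim/tensor_ind => // a x y hx hy.
by rewrite !linearP hx hy.
Qed.

End Tensor.

Arguments tensor {k} (V W)%_type.
Notation "V ⊗ W" := (tensor V W) (at level 40, left associativity) : type_scope.
Notation "v ⊗ w" := (pure_tensor v w)
  (at level 40, left associativity) : ring_scope.

Section TensorMap.
Variable k : fieldType.

Definition tensor_map (V V' W W' : lmodType k) (f : V -> V') (g : W -> W') :
    V ⊗ W -> V' ⊗ W' :=
  tensor_lift (fun v w => f v ⊗ g w).

Lemma tensor_map_bilin (V V' W W' : lmodType k)
    (f : {linear V -> V'}) (g : {linear W -> W'}) :
  bilin (fun v w => f v ⊗ g w).
Proof.
split=> [w a v v'|v a w w']; rewrite linearP.
- exact: (pure_bilin _ _).1.
- exact: (pure_bilin _ _).2.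
Qed.

Lemma tensor_mapE (V V' W W' : lmodType k)
    (f : {linear V -> V'}) (g : {linear W -> W'}) v w :
  tensor_map f g (v ⊗ w) = f v ⊗ g w.
Proof. exact: (tensor_liftE (tensor_map_bilin f g)). Qed.

Fact tensor_map_linear (V V' W W' : lmodType k)
    (f : {linear V -> V'}) (g : {linear W -> W'}) : linear (tensor_map f g).
Proof. exact: (tensor_lift_linear (tensor_map_bilin f g)). Qed.

HB.instance Definition _ (V V' W W' : lmodType k)
    (f : {linear V -> V'}) (g : {linear W -> W'}) :=
  GRing.isLinear.Build k (V ⊗ W)%type (V' ⊗ W')%type *:%R (tensor_map f g)
    (tensor_map_linear f g).

Lemma tensor_map_comp (V V' V'' W W' W'' : lmodType k)
    (f : {linear V -> V'}) (g : {linear W -> W'})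
    (f' : {linear V' -> V''}) (g' : {linear W' -> W''}) t :
  tensor_map f' g' (tensor_map f g t) = tensor_map (f' \o f) (g' \o g) t.
Proof.
apply: (tensor_ext
  (f := tensor_map f' g' \o tensor_map f g)
  (g := tensor_map (f' \o f) (g' \o g))) => v w /=.
by rewrite !tensor_mapE.
Qed.

Lemma tensor_map_id (V W : lmodType k) (f : {linear V -> V})
    (g : {linear W -> W}) :
  f =1 id -> g =1 id -> tensor_map f g =1 id.
Proof.
move=> f1 g1; apply: (tensor_ext (f := tensor_map f g) (g := idfun)) => v w /=.
by rewrite tensor_mapE f1 g1.
Qed.

Lemma eq_tensor_map (V V' W W' : lmodType k)
    (f f' : {linear V -> V'}) (g g' : {linear W -> W'}) :
  f =1 f' -> g =1 g' -> tensor_map f g =1 tensor_map f' g'.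
Proof.
move=> ff gg.
apply: (tensor_ext (f := tensor_map f g) (g := tensor_map f' g')) => v w /=.
by rewrite !tensor_mapE ff gg.
Qed.

Definition tensor_assoc (V W U : lmodType k) : (V ⊗ W) ⊗ U -> V ⊗ (W ⊗ U) :=
  tensor_lift (fun s u => tensor_lift (fun v w => v ⊗ (w ⊗ u)) s).

Lemma tensor_assoc_bilin1 (V W U : lmodType k) (u : U) :
  bilin (fun (v : V) (w : W) => v ⊗ (w ⊗ u)).
Proof.
split=> [w a v v'|v a w w']; first exact: (pure_bilin _ _).1.
by rewrite (pure_bilin _ _).1 (pure_bilin _ _).2.
Qed.

Lemma tensor_assoc_bilin (V W U : lmodType k) :
  bilin (fun (s : V ⊗ W) (u : U) => tensor_lift (fun v w => v ⊗ (w ⊗ u)) s).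
Proof.
split=> [u|s a u u'].
  exact: (tensor_lift_linear (tensor_assoc_bilin1 _ _ u)).
elim/tensor_ind: s => [v w|b x y hx hy].
  rewrite !(tensor_liftE (tensor_assoc_bilin1 _ _ _)).
  by rewrite (pure_bilin _ _).2 (pure_bilin _ _).2.
have L c := tensor_lift_linear (tensor_assoc_bilin1 V W c) b x y.
rewrite !{}L hx hy !scalerDr !scalerA [b * a]mulrC -!addrA; congr (_ + _).
by rewrite addrCA.
Qed.

Lemma tensor_assocE (V W U : lmodType k) (v : V) (w : W) (u : U) :
  tensor_assoc (v ⊗ w ⊗ u) = v ⊗ (w ⊗ u).
Proof.
rewrite /tensor_assoc (tensor_liftE (tensor_assoc_bilin _ _ _)).
exact: (tensor_liftE (tensor_assoc_bilin1 _ _ _)).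
Qed.

HB.instance Definition _ (V W U : lmodType k) :=
  GRing.isLinear.Build k (V ⊗ W ⊗ U)%type (V ⊗ (W ⊗ U))%type *:%R
    (@tensor_assoc V W U) (tensor_lift_linear (tensor_assoc_bilin V W U)).

Lemma tensor_assoc_natural (V V' W W' U U' : lmodType k)
    (f : {linear V -> V'}) (g : {linear W -> W'}) (h : {linear U -> U'}) t :
  tensor_assoc (tensor_map (tensor_map f g) h t) =
  tensor_map f (tensor_map g h) (tensor_assoc t).
Proof.
pose F1 : {linear _ -> _} :=
  @tensor_assoc V' W' U' \o tensor_map (tensor_map f g) h.
pose F2 : {linear _ -> _} :=
  tensor_map f (tensor_map g h) \o @tensor_assoc V W U.
suff: F1 =1 F2 by apply.
elim/tensor_ind => [s u|a x y hx hy]; last by rewrite !linearP hx hy.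
elim/tensor_ind: s => [v w|a x y hx hy].
  rewrite /F1 /F2 /= (tensor_mapE (tensor_map f g) h) /= tensor_mapE.
  by rewrite !tensor_assocE (tensor_mapE f (tensor_map g h)) /= tensor_mapE.
by rewrite (pure_bilin _ _).1 (linearP F1) (linearP F2) hx hy.
Qed.

Lemma linear_retraction (V V' : lmodType k) (f : {linear V -> V'}) :
  injective f -> exists r : {linear V' -> V}, cancel f r.
Proof.
move=> f_inj.
pose lin (C : set V') := forall a u v, C u -> C v -> C (a *: u + v).
pose P (C : set V') := lin C /\ forall v, C (f v) -> v = 0.
have [F FP Ftot|C [[Clin Cf] Cmax]] := @Zorn_bigcup V' P.
  split=> [a u v [A FA Au] [B FB Bv]|v [A FA /(FP A FA).2]] //.
  have [AB|BA] := Ftot _ _ FA FB.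
    by exists B => //; apply: (FP B FB).1 => //; apply: AB.
  by exists A => //; apply: (FP A FA).1 => //; apply: BA.
have C0 : C 0.
  apply: contrapT => nC0; apply: (Cmax (fun x => x = 0)).
    split=> [x Cx|/(_ 0 erefl)//].
    by exfalso; apply: nC0; rewrite -(addNr x) -scaleN1r; apply: Clin.
  split=> [a u v -> ->|v fv0]; first by rewrite /= scaler0 addr0.
  by apply: f_inj; rewrite fv0 linear0.
have CN u : C u -> C (- u).
  by move=> Cu; rewrite -scaleN1r -[X in C X]addr0; apply: Clin.
have CZ a u : C u -> C (a *: u).
  by move=> Cu; rewrite -[X in C X]addr0; apply: Clin.
have CD u v : C u -> C v -> C (u + v).
  by move=> Cu Cv; rewrite -[u]scale1r; apply: Clin.
have dec m : exists v, C (m - f v).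
  apply: contrapT => ndec.
  apply: (Cmax (fun x => exists a c, C c /\ x = c + a *: m)).
    split=> [x Cx|sub]; first by exists 0, x; rewrite scale0r addr0.
    apply: ndec; exists 0; rewrite linear0 subr0; apply: sub.
    by exists 1, 0; rewrite scale1r add0r.
  split=> [b u v [a [c [Cc ->]]] [a' [c' [Cc' ->]]]|v [a [c [Cc]]]].
    exists (b * a + a'), (b *: c + c'); split; first exact: Clin.
    by rewrite scalerDr scalerDl scalerA !addrA; congr (_ + _); rewrite addrAC.
  have [->|a0] := eqVneq a 0.
    by rewrite scale0r addr0 => fvc; apply: Cf; rewrite fvc.
  move=> fvE; case: ndec; exists (a^-1 *: v).
  rewrite linearZ /= fvE scalerDr scalerA mulVf // scale1r opprD addrCA subrr.
  by rewrite addr0; apply/CN/CZ.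
have uniq m v v' : C (m - f v) -> C (m - f v') -> v = v'.
  move=> h h'; apply/eqP; rewrite -subr_eq0; apply/eqP/Cf; rewrite linearB.
  have := CD _ _ (CN _ h) h'.
  by rewrite opprB addrA subrK.
pose r m := sval (cid (dec m)).
have rP m : C (m - f (r m)) by rewrite /r; case: (cid _).
have r_lin : linear r.
  move=> a u v; apply: (uniq (a *: u + v)) => //.
  rewrite linearP opprD addrACA -scalerBr; exact: Clin.
exists (HB.pack_for {linear V' -> V} r
  (GRing.isLinear.Build k V' V *:%R r r_lin)) => v /=.
by apply: (uniq (f v)); rewrite // subrr.
Qed.

Lemma tensor_map_inj (V V' W : lmodType k) (f : {linear V -> V'}) :
  injective f -> injective (tensor_map f (@idfun W)).
Proof.
move=> /linear_retraction[r fK]; apply: (can_inj (g := tensor_map r idfun)) => t.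
by rewrite tensor_map_comp tensor_map_id //; apply: fK.
Qed.

End TensorMap.

Section Inclusion.
Variables (k : fieldType) (V : lmodType k) (S S' : submodClosed V).
Hypothesis SS' : {subset S <= S'}.

Definition sub_incl (x : sub_space S) : sub_space S' :=
  exist _ (val x) (SS' (valP x)).
Fact sub_incl_linear : linear sub_incl.
Proof. by move=> a x y; apply: val_inj; rewrite !linearP. Qed.
HB.instance Definition _ := GRing.isLinear.Build k (sub_space S) (sub_space S')
  *:%R sub_incl sub_incl_linear.
End Inclusion.

(* An affine group scheme is encoded by its coordinate algebra, a commutative
   Hopf algebra over [k]. *)
Section Groups.
Variable k : fieldType.

Definition tensor_mul (A B : algType k) (s t : A ⊗ B) : A ⊗ B :=
  tensor_lift (fun a b => tensor_lift (fun c d => (a * c) ⊗ (b * d)) t) s.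

Lemma tensor_mulE (A B : algType k) (a c : A) (b d : B) :
  tensor_mul (a ⊗ b) (c ⊗ d) = (a * c) ⊗ (b * d).
Proof.
have bl a' b' : bilin (fun (x : A) (y : B) => (a' * x) ⊗ (b' * y)).
  split=> [y l x x'|x l y y'].
    by rewrite mulrDr -scalerAr; apply: (pure_bilin _ _).1.
  by rewrite mulrDr -scalerAr; apply: (pure_bilin _ _).2.
rewrite /tensor_mul tensor_liftE ?tensor_liftE //; split=> [y l x x'|x l y y'];
  elim/tensor_ind: (c ⊗ d) => [z w|r u v hu hv].
- rewrite !tensor_liftE // mulrDl -scalerAl; exact: (pure_bilin _ _).1.
- rewrite !(tensor_lift_linear (bl _ _) r u v) hu hv !scalerDr !scalerA.
  by rewrite [r * l]mulrC addrACA.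
- rewrite !tensor_liftE // mulrDl -scalerAl; exact: (pure_bilin _ _).2.
- rewrite !(tensor_lift_linear (bl _ _) r u v) hu hv !scalerDr !scalerA.
  by rewrite [r * l]mulrC addrACA.
Qed.

Record affine_group_scheme := AffineGroupScheme {
  coord_alg : comAlgType k;
  comult : {linear coord_alg -> (coord_alg ⊗ coord_alg)%type};
  counit : {lrmorphism coord_alg -> k^o};
  antipode : {lrmorphism coord_alg -> coord_alg};
  comult1 : comult 1 = 1 ⊗ 1;
  comultM : forall a b, comult (a * b) = tensor_mul (comult a) (comult b);
  comultA : forall a,
    tensor_assoc (tensor_map comult idfun (comult a)) =
    tensor_map idfun comult (comult a);
  counitl : forall a,
    tensor_lift (fun b c => (counit b : k) *: c) (comult a) = a;
  counitr : forall a,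
    tensor_lift (fun b c => (counit c : k) *: b) (comult a) = a;
  antipodel : forall a,
    tensor_lift (fun b c => antipode b * c) (comult a) = (counit a : k)%:A;
  antipoder : forall a,
    tensor_lift (fun b c => b * antipode c) (comult a) = (counit a : k)%:A
}.

Definition finite_type (G : affine_group_scheme) : Prop :=
  exists s : seq (coord_alg G), forall S : subalgClosed (coord_alg G),
    {subset s <= S} -> forall a, a \in S.

End Groups.

Section Comodules.
Variables (k : fieldType) (G : affine_group_scheme k).
Local Notation "'O(G)'" := (coord_alg G).

Record comodule := Comodule {
  comod_space :> lmodType k;
  coact : {linear comod_space -> (comod_space ⊗ O(G))%type};
  coactA : forall m,
    tensor_assoc (tensor_map coact idfun (coact m)) =
    tensor_map idfun (comult G) (coact m);
  coact_counit : forall m,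
    tensor_lift (fun n a => (counit G a : k) *: n) (coact m) = m
}.

Record comodule_hom (M N : comodule) := ComoduleHom {
  comod_map :> {linear M -> N};
  comod_mapP : forall m,
    coact N (comod_map m) = tensor_map comod_map idfun (coact M m)
}.

Lemma comodule_hom_ext (M N : comodule) (f g : comodule_hom M N) :
  f =1 g -> f = g.
Proof.
case: f g => [f fP] [g gP] /= fg.
have e : f = g.
  case: f g fg {fP gP} => [f cf] [g cg] /= fg.
  have {}fg : f = g by apply: funext.
  case: g / fg cg => -[[a] [b]]; case: cf => [[c] [d]].
  by rewrite (Prop_irrelevance a c) (Prop_irrelevance b d).
by rewrite e in fP *; congr (ComoduleHom _); apply: Prop_irrelevance.
Qed.
End Comodules.

Declare Scope category_scope.
Delimit Scope category_scope with cat.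
Local Open Scope category_scope.

Record category := Category {
  object :> Type;
  arrow : object -> object -> Type;
  identity : forall A, arrow A A;
  compose : forall A B C, arrow B C -> arrow A B -> arrow A C;
  compose_idl : forall A B (f : arrow A B), compose (identity B) f = f;
  compose_idr : forall A B (f : arrow A B), compose f (identity A) = f;
  composeA : forall A B C D (h : arrow C D) (g : arrow B C) (f : arrow A B),
    compose h (compose g f) = compose (compose h g) f
}.

Arguments arrow {c} A B.
Arguments identity {c} A.
Arguments compose {c A B C} g f.
Notation "g ∘ f" := (compose g f)
  (at level 40, left associativity) : category_scope.

Definition is_functor (C D : category) (F : C -> D)
    (Farrow : forall A B : C, arrow A B -> arrow (F A) (F B)) : Prop :=
  (forall A, Farrow A A (identity A) = identity (F A)) /\
  (forall A A' A'' (g : arrow A' A'') (f : arrow A A'),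
     Farrow A A'' (g ∘ f) = Farrow A' A'' g ∘ Farrow A A' f).

Record functor (C D : category) := Functor {
  fobj :> C -> D;
  fmap : forall A B : C, arrow A B -> arrow (fobj A) (fobj B);
  functorP : is_functor fmap
}.
Arguments fmap {C D} f {A B}.
Arguments Functor {C D fobj fmap}.

Section Subcategories.
Variables (C : category) (P : C -> Prop).

Program Definition full_subcategory : category := @Category {A : C | P A}
  (fun A B => arrow (proj1_sig A) (proj1_sig B))
  (fun A => identity (proj1_sig A))
  (fun _ _ _ g f => g ∘ f) _ _ _.
Next Obligation. by rewrite compose_idl. Qed.
Next Obligation. by rewrite compose_idr. Qed.
Next Obligation. by rewrite composeA. Qed.

Fact embedding_is_functor : @is_functor full_subcategory C
  (fun A => proj1_sig A) (fun _ _ f => f).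
Proof. by []. Qed.
Definition embedding : functor full_subcategory C :=
  Functor embedding_is_functor.
End Subcategories.

Section Abelian.
Variable C : category.

Definition is_zero_object (Z : C) : Prop :=
  forall A, (exists! f : arrow Z A, True) /\ (exists! f : arrow A Z, True).

Definition is_zero (A B : C) (f : arrow A B) : Prop :=
  exists (Z : C) (g : arrow Z B) (h : arrow A Z), is_zero_object Z /\ f = g ∘ h.

Definition is_product (A B Q : C) (p : arrow Q A) (q : arrow Q B) : Prop :=
  forall T (f : arrow T A) (g : arrow T B),
    exists! u : arrow T Q, p ∘ u = f /\ q ∘ u = g.

Definition is_coproduct (A B Q : C) (i : arrow A Q) (j : arrow B Q) : Prop :=
  forall T (f : arrow A T) (g : arrow B T),
    exists! u : arrow Q T, u ∘ i = f /\ u ∘ j = g.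

Definition is_kernel (A B : C) (f : arrow A B) (K : C) (i : arrow K A) : Prop :=
  is_zero (f ∘ i) /\
  forall T (t : arrow T A), is_zero (f ∘ t) -> exists! u : arrow T K, i ∘ u = t.

Definition is_cokernel (A B : C) (f : arrow A B) (Q : C) (q : arrow B Q) : Prop :=
  is_zero (q ∘ f) /\
  forall T (t : arrow B T), is_zero (t ∘ f) -> exists! u : arrow Q T, u ∘ q = t.

Definition is_mono (A B : C) (f : arrow A B) : Prop :=
  forall T (g h : arrow T A), f ∘ g = f ∘ h -> g = h.

Definition is_epi (A B : C) (f : arrow A B) : Prop :=
  forall T (g h : arrow B T), g ∘ f = h ∘ f -> g = h.

(* Freyd's definition; the additive structure on the hom-sets, for which
   binary products and coproducts are biproducts, is determined by it. *)
Record is_abelian : Prop := IsAbelian {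
  has_zero : exists Z : C, is_zero_object Z;
  has_products : forall A B : C,
    exists (Q : C) (p : arrow Q A) (q : arrow Q B), is_product p q;
  has_coproducts : forall A B : C,
    exists (Q : C) (i : arrow A Q) (j : arrow B Q), is_coproduct i j;
  has_kernels : forall (A B : C) (f : arrow A B),
    exists (K : C) (i : arrow K A), is_kernel f i;
  has_cokernels : forall (A B : C) (f : arrow A B),
    exists (Q : C) (q : arrow B Q), is_cokernel f q;
  mono_normal : forall (A B : C) (f : arrow A B), is_mono f ->
    exists (Q : C) (g : arrow B Q), is_kernel g f;
  epi_normal : forall (A B : C) (f : arrow A B), is_epi f ->
    exists (K : C) (g : arrow K A), is_cokernel g f
}.
End Abelian.

(* [F] preserves exactness of sequences [0 -> K -> A -> B], respectively
   [A -> B -> Q -> 0]. *)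
Definition left_exact (C D : category) (F : functor C D) : Prop :=
  forall (A B K : C) (f : arrow A B) (i : arrow K A),
    is_kernel f i -> is_kernel (fmap F f) (fmap F i).

Definition right_exact (C D : category) (F : functor C D) : Prop :=
  forall (A B Q : C) (f : arrow A B) (q : arrow B Q),
    is_cokernel f q -> is_cokernel (fmap F f) (fmap F q).

Definition exact_functor (C D : category) (F : functor C D) : Prop :=
  left_exact F /\ right_exact F.

Definition abelian_subcategory (C : category) (P : C -> Prop) : Prop :=
  is_abelian (full_subcategory P) /\ exact_functor (embedding P).

Definition is_filtered (J : category) : Prop :=
  inhabited J /\
  (forall i j : J, exists l : J, inhabited (arrow i l) /\ inhabited (arrow j l)) /\
  (forall (i j : J) (u v : arrow i j),
     exists (l : J) (w : arrow j l), w ∘ u = w ∘ v).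

Section Colimits.
Variables (J C : category) (D : functor J C).

Definition is_cocone (L : C) (c : forall j, arrow (D j) L) : Prop :=
  forall (i j : J) (u : arrow i j), c j ∘ fmap D u = c i.

Definition is_colimit (L : C) (c : forall j, arrow (D j) L) : Prop :=
  is_cocone c /\
  forall (T : C) (t : forall j, arrow (D j) T), is_cocone t ->
    exists! u : arrow L T, forall j, u ∘ c j = t j.
End Colimits.

Definition closed_under_filtered_colimits (C : category) (P : C -> Prop) :
    Prop :=
  forall (J : category) (D : functor J C) (L : C) (c : forall j, arrow (D j) L),
    is_filtered J -> (forall j, P (D j)) -> is_colimit c -> P L.

Definition is_right_adjoint (C D : category) (U : functor D C)
    (F : functor C D) : Prop :=
  exists phi : forall (A : C) (B : D), arrow (F A) B -> arrow A (U B),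
    (forall A B, bijective (phi A B)) /\
    (forall A A' B (h : arrow A' A) (f : arrow (F A) B),
       phi A' B (f ∘ fmap F h) = phi A B f ∘ h) /\
    (forall A B B' (h : arrow B B') (f : arrow (F A) B),
       phi A B' (h ∘ f) = fmap U h ∘ phi A B f).

Section ModuleCategory.
Variables (k : fieldType) (G : affine_group_scheme k).
Local Notation "'O(G)'" := (coord_alg G).

Fact comodule_id_subproof (M : comodule G) (m : M) :
  coact M m = tensor_map idfun idfun (coact M m).
Proof. by rewrite tensor_map_id. Qed.
Definition comodule_id (M : comodule G) : comodule_hom M M :=
  @ComoduleHom _ _ M M idfun (@comodule_id_subproof M).

Fact comodule_comp_subproof (M N Q : comodule G)
    (g : comodule_hom N Q) (f : comodule_hom M N) m :
  coact Q ((g \o f) m) = tensor_map (g \o f) idfun (coact M m).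
Proof. by rewrite /= !comod_mapP tensor_map_comp. Qed.
Definition comodule_comp (M N Q : comodule G)
    (g : comodule_hom N Q) (f : comodule_hom M N) : comodule_hom M Q :=
  @ComoduleHom _ _ M Q (g \o f) (comodule_comp_subproof g f).

Program Definition Mod : category :=
  @Category (comodule G) (@comodule_hom k G) comodule_id comodule_comp _ _ _.
Next Obligation. exact: comodule_hom_ext. Qed.
Next Obligation. exact: comodule_hom_ext. Qed.
Next Obligation. exact: comodule_hom_ext. Qed.

(* [N ⊗ O(G)] is identified with its image in [M ⊗ O(G)]; see
   [sub_tensor_inj]. *)
Record submodule (M : comodule G) := Submodule {
  sub_pred : submodClosed M;
  sub_stable : forall n : sub_space sub_pred,
    exists t : sub_space sub_pred ⊗ O(G),
      tensor_map val idfun t = coact M (val n)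
}.

Section Submodule.
Variables (M : comodule G) (N : submodule M).
Local Notation S := (sub_space (sub_pred N)).

Definition sub_coact (n : S) : S ⊗ O(G) := sval (cid (sub_stable n)).

Lemma sub_coactE n :
  tensor_map val idfun (sub_coact n) = coact M (val n).
Proof. by rewrite /sub_coact; case: (cid _). Qed.

Lemma sub_tensor_inj (W : lmodType k) :
  injective (tensor_map (val : S -> M) (@idfun W)).
Proof. exact/(tensor_map_inj (f := val))/val_inj. Qed.

Fact sub_coact_linear : linear sub_coact.
Proof.
move=> a x y; apply: sub_tensor_inj.
have hv : val (a *: x + y) = a *: val x + val y by exact: linearP.
have hT : tensor_map val idfun (a *: sub_coact x + sub_coact y) =
    a *: tensor_map val idfun (sub_coact x) +
    tensor_map val idfun (sub_coact y) by exact: tensor_map_linear.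
by rewrite hT !sub_coactE hv linearP.
Qed.
HB.instance Definition _ := GRing.isLinear.Build k S (S ⊗ O(G))%type *:%R
  sub_coact sub_coact_linear.

Fact sub_coactA n :
  tensor_assoc (tensor_map sub_coact idfun (sub_coact n)) =
  tensor_map idfun (comult G) (sub_coact n).
Proof.
apply: sub_tensor_inj; set x := sub_coact n.
pose v : {linear S -> M} := val.
have nat y : tensor_map v idfun (tensor_assoc y) =
    tensor_assoc (tensor_map (tensor_map v (@idfun O(G))) (@idfun O(G)) y).
  rewrite (tensor_assoc_natural v idfun idfun y).
  apply: (eq_tensor_map (f' := v) (g := idfun)
            (g' := tensor_map idfun idfun)) => // z.
  by rewrite /= tensor_map_id.
have e : tensor_map (tensor_map v (@idfun O(G))) idfun
      (tensor_map sub_coact idfun x) =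
    tensor_map (coact M) idfun (coact M (val n)).
  rewrite -sub_coactE (tensor_map_comp v idfun (coact M) idfun).
  rewrite (tensor_map_comp sub_coact idfun (tensor_map v idfun) idfun).
  apply: (eq_tensor_map (f := tensor_map v idfun \o sub_coact)
           (f' := coact M \o v) (g := idfun \o idfun) (g' := idfun \o idfun))
    => // z.
  exact: sub_coactE.
transitivity (tensor_assoc (tensor_map (coact M) idfun (coact M (val n)))).
  by rewrite -e -nat.
rewrite coactA -sub_coactE (tensor_map_comp v idfun idfun (comult G)).
rewrite (tensor_map_comp idfun (comult G) v idfun).
exact: (eq_tensor_map (f := idfun \o v) (g := comult G \o idfun)
         (f' := v \o idfun) (g' := idfun \o comult G)).
Qed.

Fact sub_coact_counit n :
  tensor_lift (fun n a => (counit G a : k) *: n) (sub_coact n) = n.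
Proof.
apply: val_inj; rewrite -[RHS]coact_counit -sub_coactE.
pose v : {linear S -> M} := val.
have bl (V : lmodType k) : bilin (fun (n : V) a => (counit G a : k) *: n).
  split=> [a b m m'|m b a a']; first by rewrite scalerDr !scalerA mulrC.
  by rewrite linearP scalerDl scalerA.
pose F1 : {linear _ -> _} := v \o tensor_lift_lin (bl S).
pose F2 : {linear _ -> _} := tensor_lift_lin (bl M) \o tensor_map v idfun.
apply: (tensor_ext (f := F1) (g := F2)) => m a /=.
rewrite (tensor_mapE v idfun) /= !(tensor_liftE (bl _)).
exact: (linearZZ v (counit G a : k) m).
Qed.

Definition subcomodule : comodule G := Comodule sub_coactA sub_coact_counit.

Definition sub_inclusion : comodule_hom subcomodule M :=
  @ComoduleHom _ _ subcomodule M val (fun n => esym (sub_coactE n)).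

End Submodule.

Variable X : submodClosed O(G).

(* [M ⊗ X] is identified with its image under the injection into
   [M ⊗ O(G)]. *)
Definition is_X_comodule (M : comodule G) : Prop :=
  forall m : M, exists t : M ⊗ sub_space X, tensor_map idfun val t = coact M m.

Definition Mod_sub : category := full_subcategory (C := Mod) is_X_comodule.
Definition embedding_X : functor Mod_sub Mod :=
  embedding (C := Mod) is_X_comodule.

Section LargestSubcomodule.
Variable M : comodule G.

Lemma is_X_subcomodule (N : submodule M) :
  is_X_comodule (subcomodule N) <->
  forall n : sub_space (sub_pred N),
    exists t : sub_space (sub_pred N) ⊗ sub_space X,
      tensor_map val val t = coact M (val n).
Proof.
pose v : {linear sub_space (sub_pred N) -> M} := val.
pose x : {linear sub_space X -> O(G)} := val.
have E t : tensor_map v idfun (tensor_map idfun x t) = tensor_map v x t.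
  rewrite (tensor_map_comp idfun x v idfun).
  exact: (eq_tensor_map (f := v \o idfun) (g := idfun \o x)).
split=> XN n; have [t tE] := XN n; exists t.
  by rewrite -E tE; apply: sub_coactE.
by apply: sub_tensor_inj; rewrite E tE -sub_coactE.
Qed.

Definition max_sub_pred : {pred M} := fun m =>
  `[< exists N : submodule M, is_X_comodule (subcomodule N) /\
        m \in sub_pred N >].

Section Mk.
Variable S : submodClosed M.
Hypothesis SX : forall n : sub_space S, exists t : sub_space S ⊗ sub_space X,
  tensor_map val val t = coact M (val n).

Fact mk_submodule_stable (n : sub_space S) : exists t : sub_space S ⊗ O(G),
  tensor_map val idfun t = coact M (val n).
Proof.
have [t tE] := SX n.
pose v : {linear sub_space S -> M} := val.
pose x : {linear sub_space X -> O(G)} := val.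
exists (tensor_map idfun x t); rewrite -tE (tensor_map_comp idfun x v idfun).
exact: (eq_tensor_map (f := v \o idfun) (g := idfun \o x) (f' := v) (g' := x)).
Qed.

Definition mk_submodule : submodule M := Submodule mk_submodule_stable.

Lemma mk_submodule_X : is_X_comodule (subcomodule mk_submodule).
Proof. exact/is_X_subcomodule. Qed.
End Mk.

Lemma tensor_incl (S S' : submodClosed M) (SS' : {subset S <= S'})
    (t : sub_space S ⊗ sub_space X) :
  tensor_map val val (tensor_map (sub_incl SS') idfun t) =
  tensor_map (val : sub_space S -> M) (val : sub_space X -> O(G)) t.
Proof.
pose v : {linear sub_space S -> M} := val.
pose v' : {linear sub_space S' -> M} := val.
pose x : {linear sub_space X -> O(G)} := val.
rewrite (tensor_map_comp (sub_incl SS') idfun v' x).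
exact: (eq_tensor_map (f := v' \o sub_incl SS') (g := x \o idfun)
          (f' := v) (g' := x)).
Qed.

Definition zero_pred : {pred M} := fun m => m == 0.
Fact zero_closed : submod_closed zero_pred.
Proof.
split=> [|a u v /eqP -> /eqP ->]; apply/eqP => //.
by rewrite scaler0 addr0.
Qed.

Definition sum_pred (N N' : submodClosed M) : {pred M} :=
  fun m => `[< exists u v, [/\ u \in N, v \in N' & m = u + v] >].
Fact sum_closed N N' : submod_closed (sum_pred N N').
Proof.
split=> [|a m m' /asboolP[u [v [uN vN ->]]] /asboolP[u' [v' [u'N v'N ->]]]];
  apply/asboolP.
  by exists 0, 0; rewrite !rpred0 addr0.
exists (a *: u + u'), (a *: v + v'); split; last by rewrite scalerDr addrACA.
- by apply: rpredD => //; apply: rpredZ.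
- by apply: rpredD => //; apply: rpredZ.
Qed.

Fact max_sub_closed : submod_closed max_sub_pred.
Proof.
split=> [|a u v /asboolP[N [NX uN]] /asboolP[N' [N'X vN']]]; apply/asboolP.
  unshelve eexists (@mk_submodule (mk_subspace zero_closed) _).
    case=> n n0; exists 0; rewrite /= (eqP n0) linear0.
    pose v0 : {linear sub_space (mk_subspace zero_closed) -> M} := val.
    pose x : {linear sub_space X -> O(G)} := val.
    pose T : {linear (sub_space (mk_subspace zero_closed) ⊗ sub_space X)%type ->
      (M ⊗ O(G))%type} := tensor_map v0 x.
    exact: (linear0 T).
  by split; [exact: mk_submodule_X | exact: (eqxx (0 : M))].
pose S := mk_subspace (@sum_closed (sub_pred N) (sub_pred N')).
have sN : {subset sub_pred N <= S}.
  by move=> w wN; apply/asboolP; exists w, 0; rewrite wN rpred0 addr0.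
have sN' : {subset sub_pred N' <= S}.
  by move=> w wN; apply/asboolP; exists 0, w; rewrite wN rpred0 add0r.
unshelve eexists (@mk_submodule S _).
  case=> n nS; have /asboolP[w [w' [wN w'N nE]]] := nS.
  have [t tE] := (is_X_subcomodule _).1 NX (exist _ w wN).
  have [t' tE'] := (is_X_subcomodule _).1 N'X (exist _ w' w'N).
  pose v1 : {linear sub_space S -> M} := val.
  pose x : {linear sub_space X -> O(G)} := val.
  pose T : {linear (sub_space S ⊗ sub_space X)%type -> (M ⊗ O(G))%type} :=
    tensor_map v1 x.
  pose s := tensor_map (sub_incl sN) (@idfun (sub_space X)) t.
  pose s' := tensor_map (sub_incl sN') (@idfun (sub_space X)) t'.
  have Ts : T s = coact M w by rewrite -tE; apply: tensor_incl.
  have Ts' : T s' = coact M w' by rewrite -tE'; apply: tensor_incl.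
  exists (s + s'); transitivity (T s + T s'); first exact: (linearD T).
  by rewrite Ts Ts' /= nE linearD.
split; first exact: mk_submodule_X.
apply/asboolP; exists (a *: u), v; split=> //.
exact: rpredZ.
Qed.

Fact max_sub_coact (n : sub_space (mk_subspace max_sub_closed)) :
  exists t : sub_space (mk_subspace max_sub_closed) ⊗ sub_space X,
    tensor_map val val t = coact M (val n).
Proof.
case: n => n nS; have /asboolP[N [NX nN]] := nS.
have sN : {subset sub_pred N <= mk_subspace max_sub_closed}.
  by move=> w wN; apply/asboolP; exists N.
have [t tE] := (is_X_subcomodule _).1 NX (exist _ n nN).
by exists (tensor_map (sub_incl sN) idfun t); rewrite tensor_incl tE.
Qed.

(* [M_X]; its underlying set [max_sub_pred] is the union of all submodules
   which are [X]-comodules. *)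
Definition max_sub : submodule M := mk_submodule max_sub_coact.

Definition max_sub_X : Mod_sub :=
  exist _ (subcomodule max_sub) (mk_submodule_X (SX := max_sub_coact)).

Definition max_sub_inclusion : arrow (embedding_X max_sub_X) M :=
  sub_inclusion max_sub.

End LargestSubcomodule.
End ModuleCategory.

(* Main.v *)
From HB Require Import structures.
Require Import Defs.
From mathcomp Require Import all_boot all_algebra.
From mathcomp Require Import boolp.

Set Implicit Arguments.
Unset Strict Implicit.
Unset Printing Implicit Defensive.

Import GRing.Theory.
Local Open Scope ring_scope.
Local Open Scope category_scope.

(** The functor [M |-> M_X] is the coreflection of comodules into
    [X]-comodules, and everything follows from two facts.

    First, the class of [X]-comodules contains zero and is closed under direct
    sums, subobjects and quotients ([X_comodule_zero], [X_comodule_sum],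
    [X_comodule_sub], [X_comodule_quot]). For a subobject [i : M -> N], a
    linear retraction of [i] carries the coaction of [N] back to that of [M],
    and [N ⊗ X] to [M ⊗ X]. A full subcategory of comodules with
    these closure properties is abelian with exact embedding
    ([abelian_full_subcategory]): kernels and cokernels are those of the
    underlying vector spaces, the kernel being a comodule because tensoring
    over a field is left exact ([tensor_map_ker]). Conversely a categorical
    kernel or cokernel in the subcategory is isomorphic to the concrete one,
    hence has the universal property among all comodules.

    Second, the image of an [X]-comodule under a homomorphism to [M] is both a
    submodule and an [X]-comodule, so it lies in [M_X] ([hom_in_max_sub]).
    Homomorphisms from [X]-comodules to [M] are thus the same as homomorphisms
    to [M_X]. This defines [(-)_X] on arrows and gives the adjunction and
    left exactness. It also gives closure under all colimits, filtered or not: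
    if [L] is a colimit of [X]-comodules, the structure maps factor through
    [L_X], so the identity of [L] does, and [L_X] is all of [L]
    ([X_comodule_colimits]). *)

(** * Linear algebra over a field *)

Section LinearAlgebra.
Variable k : fieldType.

(** A function with a proof of linearity, packed as a linear map. *)
Definition mk_linear (V W : lmodType k) (f : V -> W) (f_lin : linear f) :
    {linear V -> W} :=
  HB.pack_for {linear V -> W} f (GRing.isLinear.Build k V W *:%R f f_lin).

Section Kernel.
Variables (V W : lmodType k) (f : {linear V -> W}).

(** The kernel and the image of a linear map, as subspaces. *)
Definition lin_ker_pred : {pred V} := fun v => f v == 0.

Fact lin_ker_closed : submod_closed lin_ker_pred.
Proof.
split=> [|a u v /eqP fu /eqP fv]; apply/eqP; first exact: linear0.
by rewrite linearP fu fv scaler0 addr0.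
Qed.

Definition lin_ker : submodClosed V := mk_subspace lin_ker_closed.

Lemma mem_lin_ker v : (v \in lin_ker) = (f v == 0).
Proof. by []. Qed.

Definition lin_im_pred : {pred W} := fun w => `[< exists v, f v = w >].

Fact lin_im_closed : submod_closed lin_im_pred.
Proof.
split=> [|a w w' /asboolP[v <-] /asboolP[v' <-]]; apply/asboolP.
  by exists 0; apply: linear0.
by exists (a *: v + v'); apply: linearP.
Qed.

Definition lin_im : submodClosed W := mk_subspace lin_im_closed.

Lemma mem_lin_im w : (w \in lin_im) = `[< exists v, f v = w >].
Proof. by []. Qed.

(** A linear map whose values lie in a subspace, as a map to that subspace. *)
Section Corestriction.
Variables (S : submodClosed W) (fS : forall v, f v \in S).

Definition lin_corestr (v : V) : sub_space S := exist _ (f v) (fS v).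

Fact lin_corestr_linear : linear lin_corestr.
Proof. by move=> a u v; apply: val_inj; rewrite /= !linearP. Qed.

HB.instance Definition _ := GRing.isLinear.Build k V (sub_space S) *:%R
  lin_corestr lin_corestr_linear.

End Corestriction.

(** Every linear map [f] has a generalized inverse [s]. Take a retraction [r]
    of the inclusion of the kernel; then [v |-> (r v, f v)] is injective, and
    a retraction of it gives [s] on the second factor. *)
Lemma linear_quasi_inverse :
  exists s : {linear W -> V}, forall v, f (s (f v)) = f v.
Proof.
have [r rK] := @linear_retraction k _ _
  (val : {linear sub_space lin_ker -> V}) val_inj.
pose g (v : V) : sub_space lin_ker * W := (r v, f v).
have g_lin : linear g by move=> a u v; rewrite /g !linearP.
pose gL := mk_linear g_lin.
have ker_id v : f v = 0 -> val (r v) = v.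
  move/eqP; rewrite -mem_lin_ker => vk.
  exact: (congr1 val (rK (exist _ v vk))).
have gL_inj : injective gL.
  move=> u v [ruv fuv]; apply/eqP; rewrite -subr_eq0; apply/eqP.
  have fz : f (u - v) = 0 by rewrite linearB fuv subrr.
  by rewrite -(ker_id _ fz) linearB ruv subrr.
have [h hK] := linear_retraction gL_inj.
have s_lin : linear (fun w => h (0, w)).
  move=> a w w'; rewrite -linearP; congr (h _).
  by congr (_, _); rewrite /= scaler0 addr0.
exists (mk_linear s_lin) => v /=.
have e : h (0, f v) = v - val (r v).
  have rr : r (val (r v)) = r v by apply: rK.
  have f0 : f (val (r v)) = 0 by apply/eqP; apply: (valP (r v)).
  rewrite -[RHS]hK /= /g linearB linearB rr f0 subrr subr0 //.
rewrite e linearB.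
have -> : f (val (r v)) = 0 by apply/eqP; apply: (valP (r v)).
by rewrite subr0.
Qed.

End Kernel.

Lemma linear_section (V W : lmodType k) (q : {linear V -> W}) :
  (forall w, exists v, q v = w) -> exists s : {linear W -> V}, cancel s q.
Proof.
move=> q_surj; have [s sP] := linear_quasi_inverse q.
by exists s => w; have [v <-] := q_surj w.
Qed.

Section TensorMapAdditive.
Variables (V V' W : lmodType k).

Lemma tensor_map0l (f : {linear V -> V'}) t :
  (forall v, f v = 0) -> tensor_map f (@idfun W) t = 0.
Proof.
move=> f0; apply: (tensor_ext (f := tensor_map f idfun) (g := \0)) => v w.
rewrite /= tensor_mapE f0 /=.
by have := (pure_bilin V' W).1 w (-1) 0 0; rewrite /= !scaleN1r !addNr.
Qed.

Lemma tensor_mapDl (f g h : {linear V -> V'}) t :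
  (forall v, h v = f v + g v) ->
  tensor_map h (@idfun W) t = tensor_map f idfun t + tensor_map g idfun t.
Proof.
move=> hE; apply: (tensor_ext (f := tensor_map h idfun)
  (g := tensor_map f idfun \+ tensor_map g idfun)) => v w /=.
rewrite !tensor_mapE hE -[f v]scale1r (pure_bilin _ _).1.
by rewrite !scale1r.
Qed.

End TensorMapAdditive.

(** Left exactness of [- ⊗ W]. If [f s f = f], then [1 - s f] maps [V] to the
    kernel of [f], and applying it to [t] gives the preimage. *)
Lemma tensor_map_ker (V V' W : lmodType k) (f : {linear V -> V'})
    (t : V ⊗ W) :
  tensor_map f (@idfun W) t = 0 ->
  exists u : sub_space (lin_ker f) ⊗ W, tensor_map val idfun u = t.
Proof.
have [s sP] := linear_quasi_inverse f.
pose d : {linear V -> V} := idfun \- (s \o f).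
have dk v : d v \in lin_ker f.
  by rewrite mem_lin_ker /= linearB sP subrr.
pose v0 : {linear sub_space (lin_ker f) -> V} := val.
move=> ft0; exists (tensor_map (lin_corestr dk) idfun t).
rewrite (tensor_map_comp (lin_corestr dk) idfun v0 idfun).
transitivity (tensor_map d (@idfun W) t).
  exact: (eq_tensor_map (f := v0 \o lin_corestr dk) (g := idfun \o idfun)
            (f' := d) (g' := idfun)).
rewrite -[RHS](tensor_map_id (f := idfun) (g := idfun)) //.
rewrite (tensor_mapDl (f := d) (g := s \o f) (h := idfun)) => [|v]; last first.
  by rewrite /d /= subrK.
suff -> : tensor_map (s \o f) idfun t =
    tensor_map s idfun (tensor_map f idfun t).
  by rewrite ft0 linear0 addr0.
rewrite (tensor_map_comp f idfun s idfun).
exact: (eq_tensor_map (f := s \o f) (g := idfun \o idfun)).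
Qed.

End LinearAlgebra.

(** * Homomorphisms of comodules *)

Section ComoduleHoms.
Variables (k : fieldType) (G : affine_group_scheme k).
Local Notation "'O(G)'" := (coord_alg G).

Lemma tensor_counit_bilin (V : lmodType k) :
  bilin (fun (n : V) (a : O(G)) => (counit G a : k) *: n).
Proof.
split=> [a b m m'|m b a a']; first by rewrite scalerDr !scalerA mulrC.
by rewrite linearP scalerDl scalerA.
Qed.

(** A linear map [c] on [N] that is compatible with the coaction of [M] along
    [f] satisfies the comodule axioms on the image of [f]. Coactions on sums
    and quotients are checked on such images. *)
Section CoactionOnImage.
Variables (M : comodule G) (N : lmodType k).
Variables (c : {linear N -> (N ⊗ O(G))%type}) (f : {linear M -> N}).
Hypothesis cf : forall m, c (f m) = tensor_map f idfun (coact M m).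

Lemma coactA_image m :
  tensor_assoc (tensor_map c idfun (c (f m))) =
  tensor_map idfun (comult G) (c (f m)).
Proof.
rewrite cf (tensor_map_comp f idfun c idfun).
rewrite (tensor_map_comp f idfun idfun (comult G)).
rewrite (eq_tensor_map (f := c \o f) (g := idfun \o idfun)
  (f' := tensor_map f idfun \o coact M) (g' := idfun \o idfun)) //.
rewrite -(tensor_map_comp (coact M) idfun (tensor_map f idfun) idfun).
rewrite (tensor_assoc_natural f idfun idfun) coactA.
rewrite (tensor_map_comp idfun (comult G) f (tensor_map idfun idfun)).
apply: (eq_tensor_map (f := f \o idfun) (f' := idfun \o f)
  (g := tensor_map idfun idfun \o comult G) (g' := comult G \o idfun)) => // a.
by rewrite /= tensor_map_id.
Qed.

Lemma coact_counit_image m :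
  tensor_lift (fun n a => (counit G a : k) *: n) (c (f m)) = f m.
Proof.
rewrite cf -[in RHS](coact_counit m).
pose F1 : {linear _ -> _} :=
  tensor_lift_lin (tensor_counit_bilin N) \o tensor_map f (@idfun O(G)).
pose F2 : {linear _ -> _} := f \o tensor_lift_lin (tensor_counit_bilin M).
apply: (tensor_ext (f := F1) (g := F2)) => n a /=.
rewrite (tensor_mapE f idfun) /= !(tensor_liftE (tensor_counit_bilin _)).
by rewrite linearZ.
Qed.

End CoactionOnImage.

(** A linear retraction of [i] produces the factorization; it commutes with the
    coactions because [i ⊗ 1] is injective. *)
Lemma comodule_hom_factor_inj (T K A : comodule G) (t : comodule_hom T A)
    (i : comodule_hom K A) :
  injective i -> (forall x, exists y, i y = t x) ->
  exists u : comodule_hom T K, forall x, i (u x) = t x.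
Proof.
move=> i_inj ti; have [r rK] := linear_retraction i_inj.
have irt x : i (r (t x)) = t x by have [y <-] := ti x; rewrite rK.
have uP x : coact K ((r \o t) x) = tensor_map (r \o t) idfun (coact T x).
  apply: (tensor_map_inj i_inj).
  rewrite -comod_mapP /= irt comod_mapP.
  rewrite (tensor_map_comp (r \o t) idfun i idfun).
  apply: (eq_tensor_map (f := t) (g := idfun)
    (f' := i \o (r \o t)) (g' := idfun \o idfun)) => // y.
  by rewrite /= irt.
by exists (@ComoduleHom _ _ T K (r \o t) uP).
Qed.

(** A linear section [s] of [q] produces the factorization [t s], since [t]
    vanishes on the kernel of [q]. *)
Lemma comodule_hom_factor_surj (B Q T : comodule G) (t : comodule_hom B T)
    (q : comodule_hom B Q) :
  (forall y, exists b, q b = y) -> (forall b, q b = 0 -> t b = 0) ->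
  exists u : comodule_hom Q T, forall b, u (q b) = t b.
Proof.
move=> q_surj qt; have [s sK] := linear_section q_surj.
have tsq b : t (s (q b)) = t b.
  apply/eqP; rewrite -subr_eq0 -linearB; apply/eqP/qt.
  by rewrite linearB sK subrr.
have uP y : coact T ((t \o s) y) = tensor_map (t \o s) idfun (coact Q y).
  have [b <-] := q_surj y.
  rewrite comod_mapP (tensor_map_comp q idfun (t \o s) idfun) /= tsq comod_mapP.
  apply: (eq_tensor_map (f := t) (g := idfun)
    (f' := (t \o s) \o q) (g' := idfun \o idfun)) => // x.
  by rewrite /= tsq.
by exists (@ComoduleHom _ _ Q T (t \o s) uP).
Qed.

(** * Zero object and biproducts of comodules *)

Fact zero_hom_subproof (M N : comodule G) m :
  coact N ((\0 : {linear M -> N}) m) =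
  tensor_map (\0 : {linear M -> N}) idfun (coact M m).
Proof. by rewrite linear0 tensor_map0l. Qed.

(** The zero homomorphism. *)
Definition zero_hom (M N : comodule G) : comodule_hom M N :=
  @ComoduleHom _ _ M N \0 (@zero_hom_subproof M N).

Section ZeroComodule.
Local Notation V0 := ('rV[k]_0).
Local Notation c0 := (\0 : {linear V0 -> (V0 ⊗ O(G))%type}).

Fact zero_coactA m :
  tensor_assoc (tensor_map c0 idfun (c0 m)) =
  tensor_map idfun (comult G) (c0 m).
Proof. by rewrite /= !linear0. Qed.

Fact zero_coact_counit m :
  tensor_lift (fun n a => (counit G a : k) *: n) (c0 m) = m.
Proof. by rewrite [LHS]thinmx0 [RHS]thinmx0. Qed.

(** The zero space is realised as row vectors of length 0. *)
Definition zero_comodule : comodule G := Comodule zero_coactA zero_coact_counit.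

Lemma zero_comoduleE (x : zero_comodule) : x = 0.
Proof. exact: thinmx0. Qed.
End ZeroComodule.

Section Biproduct.
Variables M N : comodule G.
Local Notation MN := (M * N)%type.

(** The linear inclusions of the summands of [M * N]. *)
Definition inl_lin (m : M) : MN := (m, 0).
Definition inr_lin (n : N) : MN := (0, n).
Fact inl_lin_linear : linear inl_lin.
Proof. by move=> a x y; congr (_, _); rewrite /= scaler0 addr0. Qed.
Fact inr_lin_linear : linear inr_lin.
Proof. by move=> a x y; congr (_, _); rewrite /= scaler0 addr0. Qed.
HB.instance Definition _ := GRing.isLinear.Build k M MN *:%R
  inl_lin inl_lin_linear.
HB.instance Definition _ := GRing.isLinear.Build k N MN *:%R
  inr_lin inr_lin_linear.

(** The coaction on the sum: that of [M] on the first summand and that of [N]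
    on the second. *)
Definition sum_coact (x : MN) : MN ⊗ O(G) :=
  tensor_map inl_lin idfun (coact M x.1) +
  tensor_map inr_lin idfun (coact N x.2).
Fact sum_coact_linear : linear sum_coact.
Proof.
move=> a x y; rewrite /sum_coact /= !linearP.
by rewrite scalerDr addrACA.
Qed.
HB.instance Definition _ := GRing.isLinear.Build k MN (MN ⊗ O(G))%type *:%R
  sum_coact sum_coact_linear.

Lemma sum_coact_inl m :
  sum_coact (inl_lin m) = tensor_map inl_lin idfun (coact M m).
Proof. by rewrite /sum_coact /= !linear0 addr0. Qed.

Lemma sum_coact_inr n :
  sum_coact (inr_lin n) = tensor_map inr_lin idfun (coact N n).
Proof. by rewrite /sum_coact /= !linear0 add0r. Qed.

Lemma pair_inl_inr (x : MN) : x = inl_lin x.1 + inr_lin x.2.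
Proof. by case: x => m n; congr (_, _); rewrite /= ?addr0 ?add0r. Qed.

Fact sum_coactA x :
  tensor_assoc (tensor_map sum_coact idfun (sum_coact x)) =
  tensor_map idfun (comult G) (sum_coact x).
Proof.
pose F1 : {linear MN -> _} := @tensor_assoc k MN O(G) O(G) \o
  (tensor_map sum_coact idfun \o sum_coact).
pose F2 : {linear MN -> _} := tensor_map idfun (comult G) \o sum_coact.
suff: F1 x = F2 x by [].
rewrite [x]pair_inl_inr (linearD F1) (linearD F2); congr (_ + _).
  exact: (coactA_image sum_coact_inl).
exact: (coactA_image sum_coact_inr).
Qed.

Fact sum_coact_counit x :
  tensor_lift (fun n a => (counit G a : k) *: n) (sum_coact x) = x.
Proof.
pose F : {linear MN -> _} :=
  tensor_lift_lin (tensor_counit_bilin MN) \o sum_coact.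
suff: F x = x by [].
rewrite [x]pair_inl_inr (linearD F); congr (_ + _).
  exact: (coact_counit_image sum_coact_inl).
exact: (coact_counit_image sum_coact_inr).
Qed.

(** The direct sum of [M] and [N]. *)
Definition sum_comodule : comodule G := Comodule sum_coactA sum_coact_counit.

Definition sum_inl : comodule_hom M sum_comodule :=
  @ComoduleHom _ _ M sum_comodule inl_lin sum_coact_inl.
Definition sum_inr : comodule_hom N sum_comodule :=
  @ComoduleHom _ _ N sum_comodule inr_lin sum_coact_inr.

Fact copair_subproof (T : comodule G) (f : comodule_hom M T)
    (g : comodule_hom N T) (h : {linear MN -> T}) x :
  (forall x, h x = f x.1 + g x.2) ->
  coact T (h x) = tensor_map h idfun (sum_coact x).
Proof.
move=> hE; rewrite hE linearD !comod_mapP.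
pose H : {linear (MN ⊗ O(G))%type -> (T ⊗ O(G))%type} := tensor_map h idfun.
rewrite [RHS](linearD H) /H /=.
rewrite (tensor_map_comp inl_lin idfun h idfun).
rewrite (tensor_map_comp inr_lin idfun h idfun).
congr (_ + _).
  apply: (eq_tensor_map (f := f) (g := idfun)
    (f' := h \o inl_lin) (g' := idfun \o idfun)) => // m.
  by rewrite /= hE linear0 addr0.
apply: (eq_tensor_map (f := g) (g := idfun)
  (f' := h \o inr_lin) (g' := idfun \o idfun)) => // n.
by rewrite /= hE linear0 add0r.
Qed.

Lemma copair_hom (T : comodule G) (f : comodule_hom M T)
    (g : comodule_hom N T) :
  exists u : comodule_hom sum_comodule T, forall x, u x = f x.1 + g x.2.
Proof.
have h_lin : linear (fun x : MN => f x.1 + g x.2).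
  by move=> a x y; rewrite !linearP scalerDr addrACA.
pose h := mk_linear h_lin.
have hP x := @copair_subproof T f g h x (fun=> erefl).
by exists (@ComoduleHom _ _ sum_comodule T h hP).
Qed.

Lemma pair_hom (T : comodule G) (f : comodule_hom T M) (g : comodule_hom T N) :
  exists u : comodule_hom T sum_comodule, forall x, u x = (f x, g x).
Proof.
have h_lin : linear (fun x => (f x, g x) : MN).
  by move=> a x y; rewrite !linearP.
pose h := mk_linear h_lin.
have hP x : sum_coact (h x) = tensor_map h idfun (coact T x).
  rewrite (tensor_mapDl (f := inl_lin \o f) (g := inr_lin \o g)) => [|y].
    rewrite /sum_coact /= !comod_mapP.
    by rewrite (tensor_map_comp f idfun inl_lin idfun)
      (tensor_map_comp g idfun inr_lin idfun).
  exact: pair_inl_inr.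
by exists (@ComoduleHom _ _ T sum_comodule h hP).
Qed.

End Biproduct.

(** * Kernels and cokernels of comodules *)

Section KernelCokernel.
Variables (A B : comodule G) (f : comodule_hom A B).

Fact ker_stable (n : sub_space (lin_ker f)) :
  exists t : sub_space (lin_ker f) ⊗ O(G),
    tensor_map val idfun t = coact A (val n).
Proof.
apply: tensor_map_ker; rewrite -comod_mapP.
have /eqP -> : f (val n) == 0 by exact: (valP n).
exact: linear0.
Qed.

(** The kernel of [f], as a subcomodule of [A]. *)
Definition ker_comodule : comodule G := subcomodule (Submodule ker_stable).
Definition ker_incl : comodule_hom ker_comodule A :=
  sub_inclusion (Submodule ker_stable).

Lemma ker_incl_inj : injective ker_incl.
Proof. exact: val_inj. Qed.

Lemma ker_inclP a : f a = 0 <-> exists x, ker_incl x = a.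
Proof.
split=> [/eqP fa|[x <-]]; first by exists (exist _ a fa).
by apply/eqP; apply: (valP x).
Qed.

Local Notation Q := (quot_space (lin_im f)).
Local Notation q := (quot_proj (lin_im f)).

Lemma quot_proj_im b : q b = 0 <-> exists a, f a = b.
Proof.
rewrite -(linear0 q); split=> [/quot_projP|[a ab]].
  by rewrite subr0 mem_lin_im => /asboolP.
by apply/quot_projP; rewrite subr0 mem_lin_im; apply/asboolP; exists a.
Qed.

(** The coaction of [B] read modulo the image of [f] on a chosen
    representative; [coker_coactE] shows that the choice does not matter. *)
Definition coker_coact (y : Q) : Q ⊗ O(G) :=
  tensor_map q idfun (coact B (repr y)).

Lemma coker_coactE b : coker_coact (q b) = tensor_map q idfun (coact B b).
Proof.
apply/eqP; rewrite -subr_eq0 -!linearB; apply/eqP.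
have /quot_proj_im[a <-] : q (repr (q b) - b) = 0.
  by apply/eqP; rewrite linearB subr_eq0; apply/eqP; apply: quot_projK.
rewrite comod_mapP /= (tensor_map_comp f idfun q idfun).
apply: (tensor_map0l (f := q \o f)) => x.
by apply/quot_proj_im; exists x.
Qed.

Fact coker_coact_linear : linear coker_coact.
Proof.
move=> a; elim/quot_ind=> x; elim/quot_ind=> y.
by rewrite -linearP !coker_coactE !linearP.
Qed.
HB.instance Definition _ := GRing.isLinear.Build k Q (Q ⊗ O(G))%type *:%R
  coker_coact coker_coact_linear.

Fact coker_coactA y :
  tensor_assoc (tensor_map coker_coact idfun (coker_coact y)) =
  tensor_map idfun (comult G) (coker_coact y).
Proof. by elim/quot_ind: y => b; apply: (coactA_image coker_coactE). Qed.

Fact coker_coact_counit y :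
  tensor_lift (fun n a => (counit G a : k) *: n) (coker_coact y) = y.
Proof. by elim/quot_ind: y => b; apply: (coact_counit_image coker_coactE). Qed.

(** The cokernel of [f], on the quotient space by its image. *)
Definition coker_comodule : comodule G :=
  Comodule coker_coactA coker_coact_counit.
Definition coker_proj : comodule_hom B coker_comodule :=
  @ComoduleHom _ _ B coker_comodule q coker_coactE.

Lemma coker_proj_surj y : exists b, coker_proj b = y.
Proof. by elim/quot_ind: y => b; exists b. Qed.

Lemma coker_projP b : coker_proj b = 0 <-> exists a, f a = b.
Proof. exact: quot_proj_im. Qed.

End KernelCokernel.

End ComoduleHoms.

(** * Full subcategories closed under sums, subobjects and quotients *)

Section ExactSequences.
Variables (k : fieldType) (G : affine_group_scheme k).

(** The sequence [0 -> K -> A -> B] is exact on underlying spaces. *)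
Definition kernel_seq (A B K : comodule G) (f : comodule_hom A B)
    (i : comodule_hom K A) : Prop :=
  injective i /\ forall a, f a = 0 <-> exists x, i x = a.

(** The sequence [A -> B -> Q -> 0] is exact on underlying spaces. *)
Definition cokernel_seq (A B Q : comodule G) (f : comodule_hom A B)
    (q : comodule_hom B Q) : Prop :=
  (forall y, exists b, q b = y) /\ forall b, q b = 0 <-> exists a, f a = b.

Lemma hom_app (M N : comodule G) (f g : comodule_hom M N) : f = g -> f =1 g.
Proof. by move->. Qed.

Lemma kernel_seq_univ (A B K T : comodule G) (f : comodule_hom A B)
    (i : comodule_hom K A) (t : comodule_hom T A) :
  kernel_seq f i -> (forall x, f (t x) = 0) ->
  exists! u : comodule_hom T K, comodule_comp i u = t.
Proof.
move=> [i_inj iP] ft.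
have [u uE] := comodule_hom_factor_inj i_inj (fun x => (iP (t x)).1 (ft x)).
exists u; split=> [|u' u'E]; apply: comodule_hom_ext => x; first exact: uE.
by apply: i_inj; rewrite uE -u'E.
Qed.

Lemma cokernel_seq_univ (A B Q T : comodule G) (f : comodule_hom A B)
    (q : comodule_hom B Q) (t : comodule_hom B T) :
  cokernel_seq f q -> (forall x, t (f x) = 0) ->
  exists! u : comodule_hom Q T, comodule_comp u q = t.
Proof.
move=> [q_surj qP] tf.
have qt b : q b = 0 -> t b = 0 by move=> /qP[a <-].
have [u uE] := comodule_hom_factor_surj q_surj qt.
exists u; split=> [|u' u'E]; apply: comodule_hom_ext => y; first exact: uE.
by have [b <-] := q_surj y; rewrite uE -u'E.
Qed.

Lemma ker_incl_seq (A B : comodule G) (f : comodule_hom A B) :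
  kernel_seq f (ker_incl f).
Proof. by split; [exact: ker_incl_inj | exact: ker_inclP]. Qed.

Lemma coker_proj_seq (A B : comodule G) (f : comodule_hom A B) :
  cokernel_seq f (coker_proj f).
Proof. by split; [exact: coker_proj_surj | exact: coker_projP]. Qed.

Lemma zero_comodule_initial (A : comodule G) :
  exists! f : comodule_hom (zero_comodule G) A, True.
Proof.
exists (zero_hom _ _); split=> // f _; apply: comodule_hom_ext => x.
by rewrite (zero_comoduleE x) !linear0.
Qed.

Lemma zero_comodule_final (A : comodule G) :
  exists! f : comodule_hom A (zero_comodule G), True.
Proof.
exists (zero_hom _ _); split=> // f _; apply: comodule_hom_ext => x.
by rewrite (zero_comoduleE (f x)).
Qed.

(** A zero object has only one endomorphism, so its identity is zero. *)
Lemma unique_endo_eq0 (Z : comodule G) :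
  (exists! f : comodule_hom Z Z, True) -> forall x : Z, x = 0.
Proof.
move=> [f [_ f_uniq]] x; transitivity (f x).
  by rewrite (f_uniq (comodule_id Z) I).
by rewrite (f_uniq (zero_hom Z Z) I).
Qed.

Lemma is_zeroP_Mod (A B : Mod G) (f : arrow A B) :
  is_zero f <-> forall x, comod_map f x = 0.
Proof.
split=> [[Z [g [h [Z0 ->]]]] x|f0].
  by rewrite /= (unique_endo_eq0 (Z0 Z).1 (comod_map h x)) linear0.
exists (zero_comodule G : Mod G), (zero_hom _ _), (zero_hom _ _); split.
  move=> T; split; first exact: zero_comodule_initial.
  exact: zero_comodule_final.
by apply: comodule_hom_ext => x; rewrite f0.
Qed.

Lemma kernel_seq_Mod (A B K : Mod G) (f : arrow A B) (i : arrow K A) :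
  kernel_seq f i -> is_kernel f i.
Proof.
move=> fi; split=> [|T t /is_zeroP_Mod ft]; last exact: kernel_seq_univ fi ft.
by apply/is_zeroP_Mod => x; apply/fi.2; exists x.
Qed.

Lemma cokernel_seq_Mod (A B Q : Mod G) (f : arrow A B) (q : arrow B Q) :
  cokernel_seq f q -> is_cokernel f q.
Proof.
move=> fq; split=> [|T t /is_zeroP_Mod tf]; last exact: cokernel_seq_univ fq tf.
by apply/is_zeroP_Mod => x; apply/fq.2; exists x.
Qed.

End ExactSequences.

Section FullSubcategory.
Variables (k : fieldType) (G : affine_group_scheme k).
Variable P : comodule G -> Prop.
Hypothesis P0 : P (zero_comodule G).
Hypothesis P_sum : forall M N, P M -> P N -> P (sum_comodule M N).
Hypothesis P_sub : forall M N (f : comodule_hom M N), injective f -> P N -> P M.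
Hypothesis P_quot : forall M N (f : comodule_hom M N),
  (forall y, exists x, f x = y) -> P M -> P N.

Local Notation C := (full_subcategory (C := Mod G) P).
Local Notation hom A B := (comodule_hom (proj1_sig A) (proj1_sig B)).

Lemma zero_object_sub : is_zero_object (exist _ (zero_comodule G) P0 : C).
Proof.
by move=> T; split; [exact: zero_comodule_initial | exact: zero_comodule_final].
Qed.

Lemma is_zeroP (A B : C) (f : arrow A B) :
  is_zero f <-> forall x, comod_map (f : hom A B) x = 0.
Proof.
split=> [[Z [g [h [Z0 ->]]]] x|f0].
  have zE := unique_endo_eq0 (Z0 Z).1.
  by rewrite /= (zE (comod_map (h : hom A Z) x)) linear0.
exists (exist _ (zero_comodule G) P0 : C).
exists (zero_hom _ (proj1_sig B)), (zero_hom (proj1_sig A) _).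
split; first exact: zero_object_sub.
by apply: comodule_hom_ext => x; rewrite f0.
Qed.

Lemma kernel_seq_is_kernel (A B K : C) (f : arrow A B) (i : arrow K A) :
  kernel_seq (f : hom A B) (i : hom K A) -> is_kernel f i.
Proof.
move=> fi; split=> [|T t /is_zeroP ft]; last exact: kernel_seq_univ fi ft.
by apply/is_zeroP => x; apply/fi.2; exists x.
Qed.

Lemma cokernel_seq_is_cokernel (A B Q : C) (f : arrow A B) (q : arrow B Q) :
  cokernel_seq (f : hom A B) (q : hom B Q) -> is_cokernel f q.
Proof.
move=> fq; split=> [|T t /is_zeroP tf]; last exact: cokernel_seq_univ fq tf.
by apply/is_zeroP => x; apply/fq.2; exists x.
Qed.

(** Kernels and cokernels of comodules, as objects of the subcategory. *)
Definition ker_sub (A B : C) (f : arrow A B) : C :=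
  exist _ (ker_comodule (f : hom A B))
    (P_sub (@ker_incl_inj _ _ _ _ (f : hom A B)) (proj2_sig A)).

Definition coker_sub (A B : C) (f : arrow A B) : C :=
  exist _ (coker_comodule (f : hom A B))
    (P_quot (@coker_proj_surj _ _ _ _ (f : hom A B)) (proj2_sig B)).

(** A categorical kernel is isomorphic to the concrete one, by the uniqueness
    clauses of the two universal properties. *)
Lemma is_kernel_seq (A B K : C) (f : arrow A B) (i : arrow K A) :
  is_kernel f i -> kernel_seq (f : hom A B) (i : hom K A).
Proof.
move=> [/is_zeroP fi0 iU].
pose j : arrow (ker_sub f) A := ker_incl (f : hom A B).
have fj0 : is_zero (f ∘ j).
  by apply/is_zeroP => x; apply/(ker_inclP (f : hom A B)); exists x.
have [v [/hom_app vE _]] := iU _ j fj0.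
have [w [/hom_app wE _]] := kernel_seq_univ (ker_incl_seq (f : hom A B)) fi0.
have [u [_ u_uniq]] := iU _ i ((is_zeroP _).2 fi0).
have vwK : cancel w v.
  apply: hom_app (comodule_comp v w) (comodule_id _) _.
  rewrite -(u_uniq (comodule_comp v w)); last first.
    by apply: comodule_hom_ext => x; rewrite -[RHS]wE; apply: vE.
  by apply: u_uniq; apply: comodule_hom_ext.
split=> [x y ixy|a].
  by apply: (can_inj vwK); apply: ker_incl_inj; rewrite [LHS]wE [RHS]wE.
split=> [/ker_inclP[x <-]|[x <-]]; last exact: fi0.
by exists (v x); apply: vE.
Qed.

(** The same for cokernels. *)
Lemma is_cokernel_seq (A B Q : C) (f : arrow A B) (q : arrow B Q) :
  is_cokernel f q -> cokernel_seq (f : hom A B) (q : hom B Q).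
Proof.
move=> [/is_zeroP qf0 qU].
pose j : arrow B (coker_sub f) := coker_proj (f : hom A B).
have jf0 : is_zero (j ∘ f).
  by apply/is_zeroP => x; apply/(coker_projP (f : hom A B)); exists x.
have [v [/hom_app vE _]] := qU _ j jf0.
have [w [/hom_app wE _]] :=
  cokernel_seq_univ (coker_proj_seq (f : hom A B)) qf0.
have [u [_ u_uniq]] := qU _ q ((is_zeroP _).2 qf0).
have wvK : cancel v w.
  apply: hom_app (comodule_comp w v) (comodule_id _) _.
  rewrite -(u_uniq (comodule_comp w v)); last first.
    by apply: comodule_hom_ext => x; rewrite -[RHS]wE; apply: congr1 (vE x).
  by apply: u_uniq; apply: comodule_hom_ext.
split=> [y|b].
  have [b bE] := coker_proj_surj (v y); exists b.
  by rewrite -[LHS]wE /= bE.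
split=> [qb0|[a <-]]; last exact: qf0.
by apply/coker_projP; rewrite -[LHS]vE /= qb0 linear0.
Qed.

(** The inclusion of the kernel and the zero map agree after [f], hence are
    equal when [f] is a monomorphism. *)
Lemma mono_injective (A B : C) (f : arrow A B) :
  is_mono f -> injective (f : hom A B).
Proof.
move=> f_mono x y fxy; apply/eqP; rewrite -subr_eq0; apply/eqP.
have /ker_inclP[z <-] : (f : hom A B) (x - y) = 0 by rewrite linearB fxy subrr.
pose j : arrow (ker_sub f) A := ker_incl (f : hom A B).
pose o : arrow (ker_sub f) A := zero_hom _ (proj1_sig A).
have jo : f ∘ j = f ∘ o.
  apply: comodule_hom_ext => t; transitivity (0 : proj1_sig B).
    by apply/(ker_inclP (f : hom A B)); exists t.
  by rewrite /= linear0.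
exact: (hom_app (f_mono _ j o jo) z).
Qed.

(** The projection to the cokernel and the zero map agree on the image of [f],
    hence are equal when [f] is an epimorphism. *)
Lemma epi_surjective (A B : C) (f : arrow A B) :
  is_epi f -> forall b, exists a, (f : hom A B) a = b.
Proof.
move=> f_epi b; apply/coker_projP.
pose j : arrow B (coker_sub f) := coker_proj (f : hom A B).
pose o : arrow B (coker_sub f) := zero_hom (proj1_sig B) _.
have jo : j ∘ f = o ∘ f.
  by apply: comodule_hom_ext => t; apply/(coker_projP (f : hom A B)); exists t.
exact: (hom_app (f_epi _ j o jo) b).
Qed.

(** The direct sum, as an object of the subcategory. *)
Definition sum_sub (A B : C) : C :=
  exist _ (sum_comodule (proj1_sig A) (proj1_sig B))
    (P_sum (proj2_sig A) (proj2_sig B)).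

Lemma full_subcategory_products (A B : C) :
  exists (Q : C) (p : arrow Q A) (q : arrow Q B), is_product p q.
Proof.
have [p pE] := copair_hom (comodule_id (proj1_sig A))
                 (zero_hom (proj1_sig B) (proj1_sig A)).
have [q qE] := copair_hom (zero_hom (proj1_sig A) (proj1_sig B))
                 (comodule_id (proj1_sig B)).
have {}pE x : p x = x.1 by rewrite pE /= addr0.
have {}qE x : q x = x.2 by rewrite qE /= add0r.
exists (sum_sub A B), p, q => T f g; have [u uE] := pair_hom (f : hom T A) g.
exists u; split=> [|u' [/hom_app pu /hom_app qu]].
  by split; apply: comodule_hom_ext => x; rewrite /= ?pE ?qE uE.
apply: comodule_hom_ext => x; rewrite uE -pu -qu /= pE qE.
by rewrite -surjective_pairing.
Qed.

Lemma full_subcategory_coproducts (A B : C) :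
  exists (Q : C) (i : arrow A Q) (j : arrow B Q), is_coproduct i j.
Proof.
exists (sum_sub A B), (sum_inl (proj1_sig A) (proj1_sig B)),
  (sum_inr (proj1_sig A) (proj1_sig B)) => T f g.
have [u uE] := copair_hom (f : hom A T) g.
exists u; split=> [|u' [/hom_app pu /hom_app qu]].
  split; apply: comodule_hom_ext => x; rewrite /= uE /= linear0.
    by rewrite addr0.
  by rewrite add0r.
apply: comodule_hom_ext => x; rewrite uE -pu -qu /= -linearD.
by rewrite -pair_inl_inr.
Qed.

(** An injective [f] is the kernel of its cokernel and a surjective [f] is the
    cokernel of its kernel, so normality of monomorphisms and epimorphisms
    reduces to [mono_injective] and [epi_surjective]. *)
Lemma abelian_full_subcategory : abelian_subcategory (C := Mod G) P.
Proof.
split; last split.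
- split.
  + by exists (exist _ (zero_comodule G) P0); apply: zero_object_sub.
  + exact: full_subcategory_products.
  + exact: full_subcategory_coproducts.
  + move=> A B f; exists (ker_sub f), (ker_incl (f : hom A B)).
    exact/kernel_seq_is_kernel/ker_incl_seq.
  + move=> A B f; exists (coker_sub f), (coker_proj (f : hom A B)).
    exact/cokernel_seq_is_cokernel/coker_proj_seq.
  + move=> A B f f_mono; exists (coker_sub f), (coker_proj (f : hom A B)).
    apply: kernel_seq_is_kernel; split; first exact: mono_injective.
    exact: coker_projP.
  + move=> A B f f_epi; exists (ker_sub f), (ker_incl (f : hom A B)).
    apply: cokernel_seq_is_cokernel; split; first exact: epi_surjective.
    exact: ker_inclP.
- by move=> A B K f i /is_kernel_seq/kernel_seq_Mod.
- by move=> A B Q f q /is_cokernel_seq/cokernel_seq_Mod.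
Qed.

End FullSubcategory.

(** * X-comodules and the coreflection *)

Section XComodules.
Variables (k : fieldType) (G : affine_group_scheme k).
Local Notation "'O(G)'" := (coord_alg G).
Variable X : submodClosed O(G).
Local Notation x_incl := (val : {linear sub_space X -> O(G)}).

(** [f ⊗ 1] maps [V ⊗ X] to [V' ⊗ X], both seen in the tensor products with
    [O(G)]. *)
Lemma tensor_map_split (V V' : lmodType k) (f : {linear V -> V'})
    (t : V ⊗ sub_space X) :
  tensor_map f idfun (tensor_map idfun x_incl t) =
  tensor_map idfun x_incl (tensor_map f idfun t).
Proof.
rewrite (tensor_map_comp idfun x_incl f idfun).
rewrite (tensor_map_comp f idfun idfun x_incl).
exact: (eq_tensor_map (f := f \o idfun) (g := idfun \o x_incl)
  (f' := idfun \o f) (g' := x_incl \o idfun)).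
Qed.

(** If [i] embeds [M] in [N] and [r] is a linear retraction of [i], then
    [r ⊗ 1] carries [coact N (i m)] back to [coact M m] and [N ⊗ X] to
    [M ⊗ X]. *)
Lemma X_comodule_sub (M N : comodule G) (i : comodule_hom M N) :
  injective i -> is_X_comodule X N -> is_X_comodule X M.
Proof.
move=> i_inj NX m; have [r rK] := linear_retraction i_inj.
have [t tE] := NX (i m); exists (tensor_map r idfun t).
rewrite -tensor_map_split tE comod_mapP (tensor_map_comp i idfun r idfun).
by rewrite tensor_map_id.
Qed.

Lemma X_comodule_quot (M N : comodule G) (q : comodule_hom M N) :
  (forall y, exists x, q x = y) -> is_X_comodule X M -> is_X_comodule X N.
Proof.
move=> q_surj MX y; have [m <-] := q_surj y; have [t tE] := MX m.
by exists (tensor_map q idfun t); rewrite -tensor_map_split tE comod_mapP.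
Qed.

Lemma X_comodule_zero : is_X_comodule X (zero_comodule G).
Proof.
move=> m; exists 0.
pose T : {linear _ -> _} := tensor_map (@idfun (zero_comodule G)) x_incl.
exact: (linear0 T).
Qed.

Lemma X_comodule_sum (M N : comodule G) :
  is_X_comodule X M -> is_X_comodule X N -> is_X_comodule X (sum_comodule M N).
Proof.
move=> MX NX x; have [s sE] := MX x.1; have [t tE] := NX x.2.
exists (tensor_map (@inl_lin _ _ M N) idfun s +
        tensor_map (@inr_lin _ _ M N) idfun t).
pose T : {linear _ -> _} := tensor_map (@idfun (M * N)%type) x_incl.
rewrite [LHS](linearD T) /T /= -!tensor_map_split.
by rewrite sE tE.
Qed.

(** The image of an [X]-comodule is a submodule and an [X]-comodule. *)
Lemma hom_in_max_sub (T M : comodule G) (f : comodule_hom T M) :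
  is_X_comodule X T -> forall x, f x \in sub_pred (max_sub X M).
Proof.
move=> TX x; have fS y : f y \in lin_im f by apply/asboolP; exists y.
pose c := lin_corestr fS.
pose v : {linear sub_space (lin_im f) -> M} := val.
have SX (n : sub_space (lin_im f)) :
    exists t : sub_space (lin_im f) ⊗ sub_space X,
      tensor_map val val t = coact M (val n).
  case: n => n /[dup] /asboolP[y yn] nS; have [t tE] := TX y.
  exists (tensor_map c idfun t); rewrite /= -yn comod_mapP -tE.
  rewrite tensor_map_split (tensor_map_comp f idfun idfun x_incl).
  rewrite (tensor_map_comp c idfun v x_incl).
  exact: (eq_tensor_map (f := v \o c) (g := x_incl \o idfun)
    (f' := idfun \o f) (g' := x_incl \o idfun)).
apply/asboolP; exists (mk_submodule SX); split; first exact: mk_submodule_X.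
exact: fS.
Qed.

Local Notation largest M := (subcomodule (max_sub X M)).
Local Notation incl M := (sub_inclusion (max_sub X M)).

Lemma max_sub_incl_inj (M : comodule G) : injective (incl M).
Proof. exact: val_inj. Qed.

Lemma max_sub_factor (T M : comodule G) (f : comodule_hom T M) :
  is_X_comodule X T ->
  exists u : comodule_hom T (largest M), forall x, incl M (u x) = f x.
Proof.
move=> TX; apply: comodule_hom_factor_inj; first exact: max_sub_incl_inj.
by move=> x; exists (exist _ (f x) (hom_in_max_sub f TX x)).
Qed.

(** The unique homomorphism to [M_X] through which a homomorphism from an
    [X]-comodule to [M] factors. *)
Definition max_sub_lift (T M : comodule G) (TX : is_X_comodule X T)
    (f : comodule_hom T M) : comodule_hom T (largest M) :=
  sval (cid (max_sub_factor f TX)).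

Lemma max_sub_liftE (T M : comodule G) (TX : is_X_comodule X T)
    (f : comodule_hom T M) x : incl M (max_sub_lift TX f x) = f x.
Proof. by rewrite /max_sub_lift; case: (cid _). Qed.

(** The maps from the [D j] to the colimit [L] factor through the largest
    [X]-comodule of [L], so the identity of [L] does too. *)
Lemma X_comodule_colimits (J : category) (D : functor J (Mod G)) (L : Mod G)
    (c : forall j, arrow (D j) L) :
  (forall j, is_X_comodule X (D j)) -> is_colimit c -> is_X_comodule X L.
Proof.
move=> DX [cP cU].
pose t j : arrow (D j) (largest L : Mod G) := max_sub_lift (DX j) (c j).
have tP : is_cocone t.
  move=> i j u; apply: comodule_hom_ext => x; apply: max_sub_incl_inj.
  by rewrite !max_sub_liftE -(hom_app (cP i j u) x).
have [u [uP _]] := cU _ t tP.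
have [e [_ e_uniq]] := cU _ c cP.
have iu : comodule_comp (incl L) u = comodule_id L.
  rewrite -(e_uniq (comodule_comp (incl L) u)).
    by apply: e_uniq => j; apply: comodule_hom_ext.
  move=> j; apply: comodule_hom_ext => x /=.
  by have := hom_app (uP j) x => /= ->; apply: max_sub_liftE.
apply: (@X_comodule_quot (largest L) L (incl L)); last exact: mk_submodule_X.
by move=> y; exists (u y); exact: (hom_app iu y).
Qed.

(** The restriction of [f : M -> N] to a homomorphism [M_X -> N_X]. *)
Definition max_sub_map (M N : Mod G) (f : arrow M N) :
    arrow (max_sub_X X M) (max_sub_X X N) :=
  max_sub_lift (proj2_sig (max_sub_X X M)) (comodule_comp f (incl M)).

Lemma max_sub_mapE (M N : Mod G) (f : arrow M N) x :
  incl N (comod_map (max_sub_map f) x) = comod_map f (incl M x).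
Proof. exact: max_sub_liftE. Qed.

Lemma max_sub_map_functor :
  @is_functor (Mod G) (Mod_sub X) (max_sub_X X) max_sub_map.
Proof.
split=> [M|M N Q g f]; apply: comodule_hom_ext => x; apply: max_sub_incl_inj.
  exact: max_sub_mapE.
rewrite [LHS]max_sub_mapE [RHS]max_sub_mapE.
exact: congr1 (esym (max_sub_mapE f x)).
Qed.

(** For an [X]-comodule [T], a homomorphism [t : T -> A_X] killed by [f] factors
    through [K] by exactness, and then through [K_X] since [T] is an
    [X]-comodule. *)
Lemma max_sub_left_exact : left_exact (Functor max_sub_map_functor).
Proof.
move=> A B K f i [/is_zeroP_Mod fi0 iU]; split.
  apply/(is_zeroP X_comodule_zero) => x; apply: max_sub_incl_inj.
  by rewrite [LHS]max_sub_mapE max_sub_mapE linear0; apply: fi0.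
move=> T t /(is_zeroP X_comodule_zero) ft0.
have [u [/hom_app uE u_uniq]] : exists! u : arrow (proj1_sig T : Mod G) K,
    i ∘ u = comodule_comp (incl A) t.
  apply: iU; apply/is_zeroP_Mod => x.
  by rewrite [LHS]/= -[LHS]max_sub_mapE [X in incl _ X]ft0 linear0.
exists (max_sub_lift (proj2_sig T) u); split=> [|w wE].
  apply: comodule_hom_ext => x; apply: max_sub_incl_inj.
  by rewrite [LHS]max_sub_mapE max_sub_liftE; apply: uE.
apply: comodule_hom_ext => x; apply: max_sub_incl_inj; rewrite max_sub_liftE.
rewrite (u_uniq (comodule_comp (incl K) w)) //.
apply: comodule_hom_ext => y.
apply: etrans (esym (max_sub_mapE i _)) _.
exact: congr1 (hom_app wE y).
Qed.

Lemma max_sub_right_adjoint :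
  is_right_adjoint (Functor max_sub_map_functor) (embedding_X X).
Proof.
exists (fun A B f => max_sub_lift (proj2_sig A) f); split; last split.
- move=> A B; exists (fun g => comodule_comp (incl B) g) => f.
    by apply: comodule_hom_ext => x; apply: max_sub_liftE.
  by apply: comodule_hom_ext => x; apply: max_sub_incl_inj; apply: max_sub_liftE.
- move=> A A' B h f; apply: comodule_hom_ext => x; apply: max_sub_incl_inj.
  rewrite [LHS]max_sub_liftE; apply: esym.
  exact: (max_sub_liftE (proj2_sig A) f (comod_map h x)).
move=> A B B' h f; apply: comodule_hom_ext => x; apply: max_sub_incl_inj.
rewrite [LHS]max_sub_liftE [RHS]max_sub_mapE; apply: esym.
exact: congr1 (max_sub_liftE (proj2_sig A) f x).
Qed.

End XComodules.

Theorem theorem2p4 (k : fieldType) (p : nat) (char_k : p \in [pchar k])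
    (G : affine_group_scheme k) (G_finite_type : finite_type G)
    (X : submodClosed (coord_alg G)) :
  (abelian_subcategory (C := Mod G) (is_X_comodule X) /\
   closed_under_filtered_colimits (C := Mod G) (is_X_comodule X)) /\
  exists F : forall M N : Mod G,
      arrow M N -> arrow (max_sub_X X M) (max_sub_X X N),
    (forall (M N : Mod G) (f : arrow M N),
       max_sub_inclusion X N ∘ fmap (embedding_X X) (F M N f) =
       f ∘ max_sub_inclusion X M) /\
    exists F_functor : is_functor F,
      left_exact (Functor F_functor) /\
      is_right_adjoint (Functor F_functor) (embedding_X X).
Proof.
split; [split|].
- apply: abelian_full_subcategory.
  + exact: X_comodule_zero.
  + exact: X_comodule_sum.
  + exact: X_comodule_sub.
  + exact: X_comodule_quot.
- by move=> J D L c _; apply: X_comodule_colimits.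
exists (@max_sub_map k G X); split=> [M N f|].
  by apply: comodule_hom_ext => x; apply: max_sub_mapE.
exists (max_sub_map_functor X); split; first exact: max_sub_left_exact.
exact: max_sub_right_adjoint.
Qed.
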